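(* Let $(R,\mathfrak m)$ be a commutative Noetherian local ring, let $I$ be a principal ideal of $R$, let $J$ be an ideal of $R$, and let $M$ be a minimax $R$-module. Then $\mu^j(H^{i}_{I,J}(M))$ is finite for all $i\in\mathbb N_0$ and all $j\in\mathbb N_0$.
   Context: Let $W(I,J)=\{\mathfrak p\in\operatorname{Spec}(R): I^n\subseteq J+\mathfrak p \text{ for some positive integer } n\}$. For an $R$-module $M$, $\Gamma_{I,J}(M)=\{x\in M:\operatorname{Supp}_R(Rx)\subseteq W(I,J)\}$. The functor $\Gamma_{I,J}(-)$ is a covariant $R$-linear functor from $R$-modules to $R$-modules, and $H^i_{I,J}(-)$ denotes its $i$-th right derived functor (the $i$-th local cohomology functor with respect to $(I,J)$). For a local ring $(R,\mathfrak m)$ and an $R$-module $X$, $\mu^j(X):=\mu^j(\mathfrak m,X)=\dim_{R/\mathfrak m}\operatorname{Ext}^j_R(R/\mathfrak m,X)$ is the $j$-th Bass number of $X$ with respect to $\mathfrak m$. An $R$-module $M$ is minimax if it has a finitely generated submodule $L$ such that $M/L$ is Artinian. $\mathbb N_0$ is the set of nonnegative integers. *)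

(* Defs.v *)
From HB Require Import structures.
From mathcomp Require Import all_boot all_algebra.
From mathcomp Require Import boolp.

Set Implicit Arguments.
Unset Strict Implicit.
Unset Printing Implicit Defensive.

Import GRing.Theory.
Local Open Scope ring_scope.
Local Open Scope quotient_scope.

(* Submodules of M are the library's [submodClosed M]; ideals of R, possibly
   improper, are [submodClosed R^o]; proper ideals and primes are the library's
   [idealr R] and [prime_idealr R].  All of these are boolean predicates, which
   is no restriction because arbitrary propositions are turned into booleans by
   [`[< P >]]. *)

Section Submodules.
Variables (R : pzRingType) (M : lmodType R).

(* The library does not register that submodules are closed under opposite. *)
Definition submod_pred (N : submodClosed M) : {pred M} := N.

Fact submod_pred_closed N : submod_closed (submod_pred N).
Proof. by split=> [|a x y xN yN]; rewrite ?rpred0 // rpredD // rpredZ. Qed.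

HB.instance Definition _ N :=
  GRing.isSubmodClosed.Build R M (submod_pred N) (submod_pred_closed N).

Section Sub.
Variable N : submodClosed M.

Record submod : Type :=
  Submod { submod_val :> M; _ : submod_val \in submod_pred N }.

HB.instance Definition _ := [isSub for submod_val].
HB.instance Definition _ := [Choice of submod by <:].
HB.instance Definition _ := [SubChoice_isSubLmodule of submod by <:].
End Sub.

Definition quotmod (N : submodClosed M) : Type := {ideal_quot submod_pred N}.

HB.instance Definition _ N := GRing.Zmodule.on (quotmod N).

Section Quotient.
Variable N : submodClosed M.

Definition quotmod_proj (x : M) : quotmod N :=
  \pi_({ideal_quot submod_pred N}) x.

Definition quotmod_scale (a : R) (x : quotmod N) : quotmod N :=
  quotmod_proj (a *: repr (x : {ideal_quot submod_pred N})).

Fact quotmod_scaleE a x :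
  quotmod_scale a (quotmod_proj x) = quotmod_proj (a *: x).
Proof.
apply/eqP; rewrite /quotmod_scale /quotmod_proj -Quotient.idealrBE -scalerBr.
by apply: rpredZ; rewrite Quotient.idealrBE reprK.
Qed.

Fact quotmod_projD x y :
  quotmod_proj (x + y) = quotmod_proj x + quotmod_proj y.
Proof. by rewrite /quotmod_proj; rewrite !piE. Qed.

Fact quotmod_projP (x : quotmod N) : exists y, x = quotmod_proj y.
Proof.
by exists (repr (x : {ideal_quot submod_pred N})); rewrite /quotmod_proj reprK.
Qed.

Fact quotmod_scaleA a b x :
  quotmod_scale a (quotmod_scale b x) = quotmod_scale (a * b) x.
Proof. by have [y ->] := quotmod_projP x; rewrite !quotmod_scaleE scalerA. Qed.

Fact quotmod_scale1 : left_id 1 quotmod_scale.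
Proof.
by move=> x; have [y ->] := quotmod_projP x; rewrite quotmod_scaleE scale1r.
Qed.

Fact quotmod_scaleDr : right_distributive quotmod_scale +%R.
Proof.
move=> a x y; have [u ->] := quotmod_projP x; have [v ->] := quotmod_projP y.
by rewrite -quotmod_projD !quotmod_scaleE scalerDr quotmod_projD.
Qed.

Fact quotmod_scaleDl x : {morph quotmod_scale^~ x : a b / a + b}.
Proof.
move=> a b; have [u ->] := quotmod_projP x.
by rewrite !quotmod_scaleE scalerDl quotmod_projD.
Qed.

HB.instance Definition _ := GRing.Zmodule_isLmodule.Build R (quotmod N)
  quotmod_scaleA quotmod_scale1 quotmod_scaleDr quotmod_scaleDl.
End Quotient.

Definition finitely_generated (N : submodClosed M) : Prop :=
  exists s : seq M, forall x, (x \in N) <->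
    exists c : 'I_(size s) -> R, x = \sum_(i < size s) c i *: s`_i.

Definition artinian : Prop :=
  forall N : nat -> submodClosed M,
    (forall n, {subset N n.+1 <= N n}) ->
    exists n, forall k, (n <= k)%N -> N k =i N n.
End Submodules.

Definition minimax (R : pzRingType) (M : lmodType R) : Prop :=
  exists L : submodClosed M, finitely_generated L /\ artinian (quotmod L).

Section Rings.
Variable R : comNzRingType.

Definition noetherian_ring : Prop :=
  forall I : submodClosed R^o, finitely_generated I.

Definition maximal_ideal (m : idealr R) : Prop :=
  forall n : idealr R, {subset m <= n} -> n =i m.

Definition local_ring (m : idealr R) : Prop :=
  maximal_ideal m /\ forall n : idealr R, maximal_ideal n -> n =i m.

Definition principal_ideal (I : submodClosed R^o) : Prop :=
  exists a : R, forall x : R, (x \in I) <-> exists r : R, x = r * a.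

Definition ideal_pow (I : submodClosed R^o) (n : nat) (x : R) : Prop :=
  exists k (c : 'I_k -> R) (f : 'I_k -> 'I_n -> R),
    (forall i j, f i j \in I) /\ x = \sum_i c i * \prod_j f i j.

Definition W (I J : submodClosed R^o) (p : prime_idealr R) : Prop :=
  exists2 n : nat, (0 < n)%N &
    forall x : R, ideal_pow I n x ->
      exists a b : R, [/\ a \in J, b \in p & x = a + b].
End Rings.

Section Support.
Variables (R : comNzRingType) (M : lmodType R).

(* Equality of the fractions x / s and y / t in the localization M_p. *)
Definition loc_eq (p : prime_idealr R) (x : M) (s : R) (y : M) (t : R) : Prop :=
  exists2 u : R, u \notin p & u *: (t *: x - s *: y) = 0.

(* p belongs to the support of M when M_p is not the zero module. *)
Definition Supp (p : prime_idealr R) : Prop :=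
  exists (x : M) (s : R), s \notin p /\ ~ loc_eq p x s 0 1.

Definition cyclic_pred (x : M) : {pred M} :=
  fun y => `[< exists r : R, y = r *: x >].

Fact cyclic_submod_closed x : submod_closed (cyclic_pred x).
Proof.
split; first by apply/asboolP; exists 0; rewrite scale0r.
move=> a _ _ /asboolP[r ->] /asboolP[s ->]; apply/asboolP.
by exists (a * r + s); rewrite scalerDl scalerA.
Qed.

HB.instance Definition _ x :=
  GRing.isSubmodClosed.Build R M (cyclic_pred x) (cyclic_submod_closed x).
End Support.

(* The submodule R x, as a module. *)
Definition cyclic (R : comNzRingType) (M : lmodType R) (x : M) : lmodType R :=
  submod (cyclic_pred x).

Section Hom.
Variables (R : comNzRingType) (U V : lmodType R).

Definition hom : Type := {linear U -> V}.

Fact hom_ext (f g : {linear U -> V}) : f =1 g -> f = g.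
Proof.
case: f g => [f [[fD] [fZ]]] [g [[gD] [gZ]]] /= /funext E.
by subst g; congr (GRing.Linear.Pack (GRing.Linear.Class _ _));
  congr (_ _); exact: Prop_irrelevance.
Qed.

HB.instance Definition _ := gen_eqMixin hom.
HB.instance Definition _ := gen_choiceMixin hom.

Implicit Types (f g h : hom) (a b : R).

Definition hom_zero : hom := (\0 : {linear U -> V}).
Definition hom_opp f : hom := (\- f : {linear U -> V}).
Definition hom_add f g : hom := (f \+ g : {linear U -> V}).
Definition hom_scale a f : hom := (a \*: f : {linear U -> V}).

Fact hom_addA : associative hom_add.
Proof. by move=> f g h; apply: hom_ext => x /=; rewrite addrA. Qed.
Fact hom_addC : commutative hom_add.
Proof. by move=> f g; apply: hom_ext => x /=; rewrite addrC. Qed.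
Fact hom_add0 : left_id hom_zero hom_add.
Proof. by move=> f; apply: hom_ext => x /=; rewrite add0r. Qed.
Fact hom_addN : left_inverse hom_zero hom_opp hom_add.
Proof. by move=> f; apply: hom_ext => x /=; rewrite addNr. Qed.

HB.instance Definition _ :=
  GRing.isZmodule.Build hom hom_addA hom_addC hom_add0 hom_addN.

Fact hom_scaleA a b f : hom_scale a (hom_scale b f) = hom_scale (a * b) f.
Proof. by apply: hom_ext => x /=; rewrite scalerA. Qed.
Fact hom_scale1 : left_id 1 hom_scale.
Proof. by move=> f; apply: hom_ext => x /=; rewrite scale1r. Qed.
Fact hom_scaleDr : right_distributive hom_scale +%R.
Proof. by move=> a f g; apply: hom_ext => x /=; rewrite scalerDr. Qed.
Fact hom_scaleDl f : {morph hom_scale^~ f : a b / a + b}.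
Proof. by move=> a b; apply: hom_ext => x /=; rewrite scalerDl. Qed.

HB.instance Definition _ := GRing.Zmodule_isLmodule.Build R hom
  hom_scaleA hom_scale1 hom_scaleDr hom_scaleDl.
End Hom.

(* Covariant R-linear functors from R-modules to R-modules. *)
Record linFunctor (R : comNzRingType) := LinFunctor {
  fobj :> lmodType R -> lmodType R;
  fmap : forall U V : lmodType R, hom U V -> hom (fobj U) (fobj V);
  fmap_id : forall U : lmodType R, fmap (idfun : {linear U -> U}) =1 id;
  fmap_comp : forall (U V W : lmodType R) (g : hom V W) (f : hom U V),
    fmap (g \o f : {linear U -> W}) =1 fmap g \o fmap f;
  fmap_linear : forall (U V : lmodType R) (a : R) (f g : hom U V),
    fmap (a *: f + g) = a *: fmap f + fmap g }.

Record complex (R : comNzRingType) := Complex {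
  cobj :> nat -> lmodType R;
  diff : forall i, hom (cobj i) (cobj i.+1);
  diffK : forall i x, diff i.+1 (diff i x) = 0 }.

Section Cohomology.
Variables (R : comNzRingType) (C : complex R).

Definition cycles_pred i : {pred C i} := fun x => diff C i x == 0.
Arguments cycles_pred : clear implicits.

Fact cycles_closed i : submod_closed (cycles_pred i).
Proof.
rewrite /cycles_pred; split=> [|a x y]; rewrite unfold_in ?linear0 //.
by move=> /eqP x0 /eqP y0; rewrite unfold_in linearP x0 y0 scaler0 addr0.
Qed.

HB.instance Definition _ i :=
  GRing.isSubmodClosed.Build R (C i) (cycles_pred i) (cycles_closed i).

Definition cycles i : lmodType R := submod (cycles_pred i).

(* The incoming differential of degree 0 is zero. *)
Definition is_boundary i : C i -> Prop :=
  match i with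
  | 0 => fun x => x = 0
  | j.+1 => fun x => exists y : C j, x = diff C j y
  end.

Definition boundaries_pred i : {pred cycles i} :=
  fun z => `[< is_boundary (submod_val z) >].
Arguments boundaries_pred : clear implicits.

Fact boundaries_closed i : submod_closed (boundaries_pred i).
Proof.
split; first by apply/asboolP; case: i => //= i; exists 0; rewrite linear0.
move=> a x y /asboolP xB /asboolP yB; apply/asboolP.
case: i x y xB yB => [|i] x y /=; first by move=> -> ->; rewrite scaler0 addr0.
by move=> [u ->] [v ->]; exists (a *: u + v); rewrite linearP.
Qed.

HB.instance Definition _ i := GRing.isSubmodClosed.Build R (cycles i)
  (boundaries_pred i) (boundaries_closed i).

Definition cohomology i : lmodType R := quotmod (boundaries_pred i).
End Cohomology.

Section MapComplex.
Variables (R : comNzRingType) (F : linFunctor R) (C : complex R).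

Fact fmap0 (U V : lmodType R) : fmap F (0 : hom U V) = 0.
Proof.
have := fmap_linear F (-1) (0 : hom U V) 0.
by rewrite scaler0 addr0 scaleN1r addNr.
Qed.

Fact map_diffK i x : fmap F (diff C i.+1) (fmap F (diff C i) x) = 0.
Proof.
have <- : fmap F (0 : hom (C i) (C i.+2)) x = 0 by rewrite fmap0.
rewrite -[LHS]/((fmap F (diff C i.+1) \o fmap F (diff C i)) x) -fmap_comp.
congr (fmap F _ x); apply: hom_ext => y /=; exact: diffK.
Qed.

Definition map_complex : complex R := Complex map_diffK.
End MapComplex.

Definition injective_module (R : comNzRingType) (E : lmodType R) : Prop :=
  forall (A B : lmodType R) (f : {linear A -> B}) (g : {linear A -> E}),
    injective f -> exists h : {linear B -> E}, forall x, h (f x) = g x.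

(* 0 -> M -> E^0 -> E^1 -> ... exact, with every E^i injective. *)
Record injective_resolution (R : comNzRingType) (M : lmodType R) :=
  InjectiveResolution {
    res_complex :> complex R;
    res_aug : {linear M -> res_complex 0};
    res_injective : forall i, injective_module (res_complex i);
    res_aug_inj : injective res_aug;
    res_exact0 : forall x : res_complex 0,
      diff res_complex 0 x = 0 <-> exists y, x = res_aug y;
    res_exactS : forall i (x : res_complex i.+1),
      diff res_complex i.+1 x = 0 <-> exists y, x = diff res_complex i y }.

(* The i-th right derived functor of F at M, computed on a given injective
   resolution of M; it depends on the resolution only up to isomorphism. *)
Definition right_derived (R : comNzRingType) (F : linFunctor R)
    (M : lmodType R) (E : injective_resolution M) (i : nat) : lmodType R :=
  cohomology (map_complex F E) i.

Section HomFunctor.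
Variables (R : comNzRingType) (K : lmodType R).

Definition hom_post (U V : lmodType R) (f : hom U V) (g : hom K U) : hom K V :=
  (f \o g : {linear K -> V}).

Fact hom_post_linear U V (f : hom U V) : linear (hom_post f).
Proof. by move=> a g h; apply: hom_ext => x /=; rewrite linearP. Qed.

HB.instance Definition _ U V (f : hom U V) :=
  GRing.isLinear.Build R (hom K U) (hom K V) *:%R (hom_post f)
    (hom_post_linear f).

Definition Hom : linFunctor R.
Proof.
refine (@LinFunctor R (fun U => hom K U)
  (fun U V f => (hom_post f : {linear hom K U -> hom K V})) _ _ _).
- by move=> U g; apply: hom_ext.
- by move=> U V W g f h; apply: hom_ext.
- by move=> U V a f g; apply: hom_ext => h; apply: hom_ext.
Defined.

(* Ext^j_R(K, X), for X resolved by E. *)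
Definition Ext (X : lmodType R) (E : injective_resolution X) (j : nat) :=
  right_derived Hom E j.
End HomFunctor.

Section Torsion.
Variables (R : comNzRingType) (I J : submodClosed R^o).

Fact Supp_cyclicP (M : lmodType R) (x : M) (p : prime_idealr R) :
  Supp (cyclic x) p <-> forall u : R, u \notin p -> u *: x <> 0.
Proof.
have p1 : 1 \notin p by rewrite idealr1.
split=> [[z [s [sp nz]]] u up ux0|nz].
  apply: nz; exists u => //; rewrite scale1r scaler0 subr0.
  case: z => z zx; apply: val_inj => /=.
  case/asboolP: zx => r ->; rewrite scalerA mulrC -scalerA ux0.
  exact: scaler0.
have xx : x \in submod_pred (cyclic_pred x).
  by apply/asboolP; exists 1; rewrite scale1r.
exists (Submod xx), 1; split=> // -[u up].
by rewrite scale1r scaler0 subr0 => /(congr1 val); exact: nz.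
Qed.

Section Module.
Variable M : lmodType R.

Definition Gamma_pred : {pred M} :=
  fun x => `[< forall p : prime_idealr R, Supp (cyclic x) p -> W I J p >].

Fact Gamma_closed : submod_closed Gamma_pred.
Proof.
split.
  apply/asboolP => p /Supp_cyclicP/(_ 1); rewrite idealr1 scaler0.
  by move=> /(_ isT).
move=> a x y /asboolP xG /asboolP yG; apply/asboolP => p /Supp_cyclicP xyp.
have [/xG//|xp] := pselect (Supp (cyclic x) p).
have [/yG//|yp] := pselect (Supp (cyclic y) p).
case: xp; apply/Supp_cyclicP => u up ux0; case: yp.
apply/Supp_cyclicP => v vp vy0; apply: (xyp (u * v)).
  by rewrite prime_idealrM negb_or up.
have -> : (u * v) *: (a *: x + y) = (v * a) *: (u *: x) + u *: (v *: y).
  by rewrite scalerDr !scalerA -mulrA mulrC.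
by rewrite ux0 vy0 !scaler0 addr0.
Qed.

HB.instance Definition _ :=
  GRing.isSubmodClosed.Build R M Gamma_pred Gamma_closed.

Definition GammaM : lmodType R := submod Gamma_pred.
End Module.

Section Map.
Variables (M N : lmodType R) (f : hom M N).

Fact Gamma_map_mem (x : GammaM M) :
  f (submod_val x) \in submod_pred (@Gamma_pred N).
Proof.
case: x => x /asboolP xG /=; apply/asboolP => p /Supp_cyclicP fxp; apply: xG.
apply/Supp_cyclicP => u up ux0; apply: (fxp u up).
by rewrite -linearZ ux0 linear0.
Qed.

Definition Gamma_map (x : GammaM M) : GammaM N := Submod (Gamma_map_mem x).

Fact Gamma_map_linear : linear Gamma_map.
Proof. by move=> a x y; apply: val_inj; rewrite /= linearP. Qed.

HB.instance Definition _ :=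
  GRing.isLinear.Build R (GammaM M) (GammaM N) *:%R Gamma_map Gamma_map_linear.
End Map.

Definition Gamma : linFunctor R.
Proof.
refine (@LinFunctor R GammaM
  (fun U V f => (Gamma_map f : {linear GammaM U -> GammaM V})) _ _ _).
- by move=> U x; apply: val_inj.
- by move=> U V W' g f x; apply: val_inj.
- by move=> U V a f g; apply: hom_ext => x; apply: val_inj.
Defined.

(* H^i_{I,J}(M), for M resolved by E. *)
Definition local_cohomology (M : lmodType R) (E : injective_resolution M)
  (i : nat) : lmodType R := right_derived Gamma E i.
End Torsion.

Section Bass.
Variables (R : comNzRingType) (m : idealr R).

Definition ideal_pred : {pred R^o} := m.

Fact ideal_pred_closed : submod_closed ideal_pred.
Proof.
by split=> [|a x y xm ym]; [exact: idealr0 | exact: rpredD (idealMr a xm) ym].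
Qed.

HB.instance Definition _ :=
  GRing.isSubmodClosed.Build R R^o ideal_pred ideal_pred_closed.

(* R/m as an R-module; the ring R/m is {ideal_quot m}. *)
Definition residue_module : lmodType R := quotmod ideal_pred.

Definition residue_proj : R -> {ideal_quot m} := \pi_({ideal_quot m}).

(* dim_{R/m} V = d for an R-module V annihilated by m: its R/m-structure is the
   one inducing the R-structure through R -> R/m, so a coordinate system is a
   bijection onto (R/m)^d that is linear along R -> R/m.  Any V admitting such
   a bijection is annihilated by m. *)
Definition residue_dim (V : lmodType R) (d : nat) : Prop :=
  exists f : V -> 'rV[{ideal_quot m}]_d,
    [/\ bijective f, {morph f : x y / x + y} &
        forall (a : R) (x : V), f (a *: x) = residue_proj a *: f x].

(* mu^j(X) = d, where mu^j(X) = dim_{R/m} Ext^j_R(R/m, X), for X resolved by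
   E. *)
Definition bass_number (X : lmodType R) (E : injective_resolution X)
  (j d : nat) : Prop := residue_dim (Ext residue_module E j) d.
End Bass.

(* Main.v *)
Require Import Defs.
From HB Require Import structures.
From mathcomp Require Import all_boot all_algebra.
From mathcomp Require Import boolp.

Set Implicit Arguments.
Unset Strict Implicit.
Unset Printing Implicit Defensive.

Import GRing.Theory Defs.
Local Open Scope ring_scope.
Local Open Scope quotient_scope.

(** Write I = (a), let S be the multiplicative set of all a^n + j with j in J,
    and let k = R/m.

    The prime avoidance lemma for S shows that Gamma_{I,J}(M) is the S-torsion
    submodule of M ([GammaP]).  If S does not meet m, then S consists of units,
    so nothing is S-torsion and all local cohomology vanishes.  Otherwise fix s
    in S and m.  Over a Noetherian ring an injective module E becomes divisible
    by S after its S-torsion is factored out ([injective_divide]); hence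
    E/Gamma(E) is uniquely divisible by s, a long exact sequence gives H^i = 0
    for i >= 2 ([local_cohomology_ge2]), H^0 is a submodule of M, and there is
    an exact sequence 0 -> N -> Y -> H^1 -> 0 in which N is the image of M in
    E^0/Gamma(E^0) and s acts bijectively on Y.  The module Y is
    the localization of M at S, but it is only seen through the resolution.

    Finiteness is carried by the modules all of whose subquotients killed by m
    are finitely generated ([socle_finite]).  They form a Serre class: it is
    closed under subquotients and extensions ([subquots_fg_ext]).  It contains
    the finitely generated modules and the Artinian ones, hence the minimax ones
    ([minimax_socle_finite]), and it is stable under Hom(K, -) for K finitely
    generated ([socle_finite_hom]).

    The resolutions in the statement are arbitrary, so Ext^j(k, X) is reached by
    dimension shifting in the first argument alone: if 0 -> K' -> R^n -> K -> 0
    is exact, then Ext^j(K', X) maps onto Ext^{j+1}(K, X), and therefore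
    Ext^j(k, X) is a quotient of Hom(K_j, X) for a finitely generated K_j
    ([ext_quotient]).  As m kills Ext^j(k, X), it is finite dimensional as soon
    as X is in the class ([bass_finite_socle_finite]), which settles H^0.

    For X = H^1 the surjection q : Hom(K_j, X) -> Ext^j(k, X) annihilates the
    maps that lift to Y: such a lift is s times another map to Y, and s kills
    Ext^j(k, X).  What is left of Hom(K_j, X) embeds in Ext^1(K_j, N), a
    quotient of Hom(K_{j+1}, N), and N is a quotient of M
    ([bass_finite_divisible]). *)

(** * Submodules, quotients and linear relations *)

Section Relations.
Variable R : comNzRingType.
Implicit Types A B C M U V : lmodType R.

Definition surj (S T : Type) (f : S -> T) := forall y, exists x, y = f x.

Definition is_submod M (P : M -> Prop) : Prop :=
  P 0 /\ forall a x y, P x -> P y -> P (a *: x + y).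

Lemma is_submod_closed M (P : M -> Prop) :
  is_submod P -> exists N : submodClosed M, forall x, x \in N <-> P x.
Proof.
move=> [P0 PL].
have cl : submod_closed (fun x : M => `[< P x >]).
  split; first exact/asboolP.
  by move=> a x y /asboolP Px /asboolP Py; apply/asboolP/PL.
pose c := GRing.isSubmodClosed.Build R M _ cl.
pose N : submodClosed M := HB.pack (fun x : M => `[< P x >]) c.
by exists N => x; split=> [/asboolP|Px]; last exact/asboolP.
Qed.

Definition linmap A B (f : A -> B) (lf : linear f) : {linear A -> B} :=
  HB.pack f (GRing.isLinear.Build R A B *:%R f lf).

Lemma sub_module M (N : submodClosed M) :
  exists i : {linear submod N -> M},
    injective i /\ forall x, x \in N <-> exists u, x = i u.
Proof.
have lin : linear (@submod_val _ _ N) by [].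
exists (linmap lin); split; first exact: val_inj.
move=> x; split=> [xN|[u ->]]; last by case: u.
by exists (Submod xN).
Qed.

Lemma submodule_exists M (P : M -> Prop) : is_submod P ->
  exists (U : lmodType R) (i : {linear U -> M}),
    injective i /\ forall x, P x <-> exists u, x = i u.
Proof.
move=> /is_submod_closed[N NP]; exists (submod N).
by have [i [inj iP]] := sub_module N; exists i; split=> // x; rewrite -NP iP.
Qed.

Lemma quotmod_proj0 M (N : submodClosed M) (x : M) :
  quotmod_proj N x = 0 <-> x \in N.
Proof.
rewrite -[x in X in _ <-> X]subr0 -[_ \in N]/(_ \in submod_pred N).
rewrite Quotient.idealrBE -[0 in X in X <-> _](_ : quotmod_proj N 0 = 0).
  by split=> [/eqP//|/eqP].
by rewrite /quotmod_proj piE.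
Qed.

Lemma quot_module M (N : submodClosed M) :
  exists p : {linear M -> quotmod N},
    [/\ p =1 quotmod_proj N, surj p & forall x, p x = 0 <-> x \in N].
Proof.
have lin : linear (quotmod_proj N).
  move=> a x y; rewrite quotmod_projD; congr (_ + _).
  by rewrite -[RHS]/(quotmod_scale _ _) quotmod_scaleE.
exists (linmap lin); split=> //; first exact: quotmod_projP.
exact: quotmod_proj0.
Qed.

Lemma quotient_exists M (P : M -> Prop) : is_submod P ->
  exists (Q : lmodType R) (p : {linear M -> Q}),
    surj p /\ forall x, p x = 0 <-> P x.
Proof.
move=> /is_submod_closed[N NP]; have [p [_ ps pP]] := quot_module N.
by exists (quotmod N), p; split=> // x; rewrite -NP pP.
Qed.

(** A linear relation is a submodule of the product A x B.  Relations spare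
    the choice of representatives in connecting maps and subquotients; they are
    turned into maps by [linrel_map]. *)
Definition linrel A B (rho : A -> B -> Prop) : Prop :=
  rho 0 0 /\ forall c a b a' b',
    rho a b -> rho a' b' -> rho (c *: a + a') (c *: b + b').

Definition onto A B (rho : A -> B -> Prop) := forall b, exists a, rho a b.
Definition total A B (rho : A -> B -> Prop) := forall a, exists b, rho a b.
(** For a linear relation, this triviality over 0 means that no element has two
    images ([single_valued_eq]). *)
Definition single_valued A B (rho : A -> B -> Prop) :=
  forall b, rho 0 b -> b = 0.

Section Theory.
Variables (A B : lmodType R) (rho : A -> B -> Prop).
Hypothesis lrho : linrel rho.

Lemma linrelZ c a b : rho a b -> rho (c *: a) (c *: b).
Proof.
by move=> ab; have := lrho.2 c _ _ _ _ ab lrho.1; rewrite !addr0.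
Qed.

Lemma linrelD a b a' b' : rho a b -> rho a' b' -> rho (a + a') (b + b').
Proof. by move=> h h'; have := lrho.2 1 _ _ _ _ h h'; rewrite !scale1r. Qed.

Lemma linrelB a b a' b' : rho a b -> rho a' b' -> rho (a - a') (b - b').
Proof.
by move=> h /(linrelZ (-1)); rewrite !scaleN1r; exact: linrelD.
Qed.

Lemma linrel_sum n (c : 'I_n -> R) (a : 'I_n -> A) (b : 'I_n -> B) :
  (forall i, rho (a i) (b i)) ->
  rho (\sum_i c i *: a i) (\sum_i c i *: b i).
Proof.
move=> ab; elim/big_rec2: _ => [|i x y _ xy]; first exact: lrho.1.
exact/lrho.2/xy.
Qed.

Lemma single_valued_eq :
  single_valued rho -> forall a b b', rho a b -> rho a b' -> b = b'.
Proof.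
move=> s a b b' h h'; apply/eqP; rewrite -subr_eq0; apply/eqP/s.
by rewrite -(subrr a); exact: linrelB.
Qed.

Lemma linrel_map : total rho -> single_valued rho ->
  exists f : {linear A -> B}, forall a b, rho a b <-> b = f a.
Proof.
move=> /choice[f rf] s.
have lin : linear f.
  by move=> c x y; apply: (single_valued_eq s (rf _)); exact: lrho.2.
exists (linmap lin) => a b; split=> [|-> //].
by move=> ab; exact: single_valued_eq ab (rf a).
Qed.
End Theory.

(** B is U/U' for submodules U' of U of A: take for U the domain of the relation
    and for U' the elements related to 0. *)
Definition subquot A B := exists rho : A -> B -> Prop,
  [/\ linrel rho, onto rho & single_valued rho].

Lemma linrel_comp A B C (rho : A -> B -> Prop) (sigma : B -> C -> Prop) :
  linrel rho -> linrel sigma ->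
  linrel (fun a c => exists b, rho a b /\ sigma b c).
Proof.
move=> [r0 rL] [s0 sL]; split; first by exists 0.
move=> k a c a' c' [b [ab bc]] [b' [ab' bc']].
by exists (k *: b + b'); split; [exact: rL|exact: sL].
Qed.

Lemma subquot_trans B A C : subquot A B -> subquot B C -> subquot A C.
Proof.
move=> [rho [rl ro rs]] [sigma [sl so ss]].
exists (fun a c => exists b, rho a b /\ sigma b c); split.
- exact: linrel_comp.
- move=> c; have [b bc] := so c; have [a ab] := ro b.
  by exists a, b.
- by move=> c [b [/rs->]]; exact: ss.
Qed.

Lemma graph_linrel A B (f : {linear A -> B}) : linrel (fun a b => b = f a).
Proof. by split=> [|c a b a' b' -> ->]; rewrite ?linear0 ?linearP. Qed.

Lemma inv_linrel A B (rho : A -> B -> Prop) :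
  linrel rho -> linrel (fun b a => rho a b).
Proof. by move=> [r0 rL]; split=> // c a b a' b'; exact: rL. Qed.

Lemma subquot_surj A B (p : {linear A -> B}) : surj p -> subquot A B.
Proof.
move=> sp; exists (fun a b => b = p a); split=> //; first exact: graph_linrel.
by move=> b ->; rewrite linear0.
Qed.

Lemma subquot_inj A B (i : {linear B -> A}) : injective i -> subquot A B.
Proof.
move=> ii; exists (fun a b => a = i b); split.
- exact/inv_linrel/graph_linrel.
- by move=> b; exists (i b).
- by move=> b /esym; rewrite -(linear0 i) => /ii.
Qed.

Lemma factor_surj A B C (p : {linear A -> B}) (f : {linear A -> C}) :
  surj p -> (forall a, p a = 0 -> f a = 0) ->
  exists g : {linear B -> C}, forall a, g (p a) = f a.
Proof.
move=> sp k.
have lr : linrel (fun b c => exists a, b = p a /\ c = f a).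
  apply: (linrel_comp (rho := fun b a => b = p a)); last exact: graph_linrel.
  exact/inv_linrel/graph_linrel.
have [||g gP] := linrel_map lr.
- by move=> b; have [a ->] := sp b; exists (f a), a.
- by move=> c [a [/esym/k fa0 ->]].
- by exists g => a; apply/esym/gP; exists a.
Qed.

Lemma factor_inj A B C (i : {linear B -> C}) (f : {linear A -> C}) :
  injective i -> (forall a, exists b, f a = i b) ->
  exists g : {linear A -> B}, forall a, i (g a) = f a.
Proof.
move=> ii k.
have lr : linrel (fun a b => exists c, c = f a /\ c = i b).
  apply: (linrel_comp (rho := fun a c => c = f a)); first exact: graph_linrel.
  exact/inv_linrel/graph_linrel.
have [||g gP] := linrel_map lr.
- by move=> a; have [b fb] := k a; exists b, (f a).
- by move=> b [c [->]]; rewrite linear0 -{1}(linear0 i) => /ii.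
- exists g => a; have /gP[c [-> //]] : g a = g a by [].
Qed.

(** * Finitely generated modules *)

Definition lincomb n V (y : 'I_n -> V) (w : 'rV[R]_n) : V :=
  \sum_i w 0 i *: y i.

Fact lincomb_linear n V (y : 'I_n -> V) : linear (lincomb y).
Proof.
move=> a u v; rewrite /lincomb scaler_sumr -big_split /=; apply: eq_bigr => i _.
by rewrite !mxE scalerDl scalerA.
Qed.

HB.instance Definition _ n V (y : 'I_n -> V) :=
  GRing.isLinear.Build R 'rV[R]_n V *:%R (lincomb y) (lincomb_linear y).

Lemma lincombE n V (f : {linear 'rV[R]_n -> V}) w :
  f w = lincomb (fun i => f (delta_mx 0 i)) w.
Proof.
rewrite {1}(row_sum_delta w) linear_sum /lincomb.
by apply: eq_bigr => i _; rewrite linearZ.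
Qed.

Lemma lift_free n A B (p : {linear A -> B}) (f : {linear 'rV[R]_n -> B}) :
  (forall w, exists a, f w = p a) ->
  exists g : {linear 'rV[R]_n -> A}, forall w, p (g w) = f w.
Proof.
move=> h.
have /choice[y yP] : forall i : 'I_n, exists a, f (delta_mx 0 i) = p a.
  by move=> i; exact: h.
exists (lincomb y : {linear _ -> _}) => w.
rewrite [RHS]lincombE /= /lincomb linear_sum.
by apply: eq_bigr => i _; rewrite linearZ /= yP.
Qed.

Fact row0_linear n : linear (@row_mx R 1 1 n 0).
Proof. by move=> a u v; rewrite scale_row_mx add_row_mx scaler0 addr0. Qed.

Fact rsub_linear n : linear (@rsubmx R 1 1 n).
Proof. by move=> a u v; rewrite linearP. Qed.

Fact head_linear n : linear (fun w : 'rV[R]_n.+1 => w 0 0 : R^o).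
Proof. by move=> a u v; rewrite !mxE. Qed.

(** Splits off the first coordinate: R^(n+1) is an extension of R by R^n, which
    is what inductions on the rank use. *)
Lemma split_head n (w : 'rV[R]_n.+1) :
  w = w 0 0 *: row_mx (1 : 'rV[R]_1) 0 + row_mx 0 (@rsubmx R 1 1 n w).
Proof.
rewrite -{1}(@hsubmxK R 1 1 n w) scale_row_mx add_row_mx scaler0 add0r addr0.
apply: (f_equal2 (@row_mx R 1 1 n)) => //.
apply/matrixP => i j; rewrite !ord1 !mxE mulr1.
by congr (w _ _); exact: val_inj.
Qed.

Fact precomp_linear A B M (p : {linear A -> B}) :
  linear (fun f : hom B M => (f \o p : {linear A -> M}) : hom A M).
Proof. by move=> a f g; apply: hom_ext. Qed.

Definition fg V := exists n (p : {linear 'rV[R]_n -> V}), surj p.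

Lemma fg_seq V (s : seq V) :
  (forall x, exists c : 'I_(size s) -> R, x = \sum_(i < size s) c i *: s`_i) ->
  fg V.
Proof.
move=> h; exists (size s).
exists (lincomb (fun i : 'I_(size s) => s`_i) : {linear _ -> _}).
move=> x; have [c ->] := h x; exists (\row_i c i); apply: eq_bigr => i _.
by rewrite mxE.
Qed.

Lemma fg_ext A B C (f : {linear A -> B}) (g : {linear B -> C}) :
  (forall b, g b = 0 -> exists a, b = f a) -> surj g -> fg A -> fg C -> fg B.
Proof.
move=> ex sg [n [p sp]] [l [q sq]].
have [r rP] : exists r : {linear 'rV[R]_l -> B}, forall w, g (r w) = q w.
  by apply: lift_free => w; have [b ->] := sg (q w); exists b.
pose h (w : 'rV[R]_(n + l)) : B := f (p (lsubmx w)) + r (rsubmx w).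
have lin : linear h.
  by move=> a u v; rewrite /h !linearP scalerDr addrACA.
exists (n + l)%N, (linmap lin) => b /=.
have [w gw] := sq (g b).
have [a ba] : exists a, b - r w = f a.
  by apply: ex; rewrite linearB /= rP gw subrr.
have [v av] := sp a; exists (row_mx v w).
by rewrite /h row_mxKl row_mxKr -av -ba subrK.
Qed.

(** * Modules whose subquotients are finitely generated *)

(** Used for two properties P of the subquotients: the trivial one, which gives
    the Noetherian modules, and being killed by m. *)
Definition subquots_fg (P : lmodType R -> Prop) M :=
  forall V, subquot M V -> P V -> fg V.

Lemma subquots_fg_subquot P A B :
  subquot A B -> subquots_fg P A -> subquots_fg P B.
Proof. by move=> AB PA V BV; apply: PA; exact: subquot_trans BV. Qed.

Lemma fg_trivial V : (forall v : V, v = 0) -> fg V.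
Proof.
by move=> V0; exists 0%N, (\0 : {linear _ -> _}) => v; exists 0; rewrite [v]V0.
Qed.

Lemma subquots_fg_trivial P A : (forall a : A, a = 0) -> subquots_fg P A.
Proof.
move=> A0 V [rho [_ ro rs]] _; apply: fg_trivial => v.
by have [a] := ro v; rewrite [a]A0 => /rs.
Qed.

(** A subquotient V of B is itself an extension: the part V' of V that comes
    from A is a subquotient of A, and V/V' is a subquotient of C. *)
Lemma subquots_fg_ext (P : lmodType R -> Prop) A B C
    (f : {linear A -> B}) (g : {linear B -> C}) :
  (forall V W, subquot V W -> P V -> P W) ->
  (forall b, g b = 0 -> exists a, b = f a) ->
  subquots_fg P A -> subquots_fg P C -> subquots_fg P B.
Proof.
move=> PP ex PA PC V [rho [rl ro rs]] PV.
pose V'P v := exists a, rho (f a) v.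
have V'c : is_submod V'P.
  split; first by exists 0; rewrite linear0; exact: rl.1.
  move=> c x y [a ax] [b bY]; exists (c *: a + b); rewrite linearP.
  exact: rl.2.
have [V' [i [ii iP]]] := submodule_exists V'c.
have [V'' [p [sp pP]]] := quotient_exists V'c.
apply: (@fg_ext V' V V'' i p) => //.
- by move=> b /pP/iP.
- apply: PA; last by apply: PP PV; exact: subquot_inj ii.
  exists (fun a v => rho (f a) (i v)); split.
  + split; first by rewrite !linear0; exact: rl.1.
    by move=> c a b a' b' h h'; rewrite !linearP; exact: rl.2.
  + by move=> v; have [a] := (iP (i v)).2 (ex_intro _ v erefl); exists a.
  + by move=> v; rewrite linear0 => /rs; rewrite -(linear0 i) => /ii.
- apply: PC; last by apply: PP PV; exact: subquot_surj sp.
  exists (fun c v => exists b, c = g b /\ exists w, rho b w /\ v = p w).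
  split.
  + apply: (linrel_comp (rho := fun c b => c = g b)).
      exact/inv_linrel/graph_linrel.
    by apply: (linrel_comp rl); exact: graph_linrel.
  + move=> v; have [w ->] := sp v; have [b bw] := ro w.
    by exists (g b), b; split=> //; exists w.
  + move=> v [b [/esym/ex[a ->] [w [aw ->]]]]; apply/pP.
    by exists a.
Qed.
End Relations.

(** * Noetherian rings *)

Section Noetherian.
Variable R : comNzRingType.
Implicit Types A B C M U V : lmodType R.

Definition noetherian M := subquots_fg (fun _ => True) M.

Lemma generator_in M (N : submodClosed M) (s : seq M) :
  (forall x, x \in N <->
    exists c : 'I_(size s) -> R, x = \sum_(i < size s) c i *: s`_i) ->
  forall i : 'I_(size s), s`_i \in N.
Proof.
move=> sP i; apply/sP; exists (fun j => (j == i)%:R).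
rewrite (bigD1 i) //= eqxx scale1r big1 ?addr0 // => j /negPf ->.
by rewrite scale0r.
Qed.

Hypothesis noeth : noetherian_ring R.

(** The domain of the relation is an ideal; images of its generators generate
    the subquotient. *)
Lemma noetherian_regular : noetherian R^o.
Proof.
move=> V [rho [rl ro rs]] _.
pose D (r : R^o) := exists v, rho r v.
have Dc : is_submod D.
  split; first by exists 0; exact: rl.1.
  by move=> a x y [v xv] [w yw]; exists (a *: v + w); exact: rl.2.
have [N NP] := is_submod_closed Dc.
have [s sP] := noeth N.
have sN (i : 'I_(size s)) : D s`_i by apply/NP; exact: generator_in sP i.
have [v vP] := choice sN.
exists (size s), (lincomb v : {linear _ -> _}) => x.
have [r rx] := ro x.
have /NP/sP[c rE] : D r by exists x.
exists (\row_i c i); apply: (single_valued_eq rl rs rx); rewrite rE /=.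
have -> : lincomb v (\row_i c i) = \sum_i c i *: v i.
  by apply: eq_bigr => i _; rewrite mxE.
exact: linrel_sum.
Qed.

Lemma noetherian_free n : noetherian 'rV[R]_n.
Proof.
elim: n => [|n IH]; first by apply: subquots_fg_trivial => w; exact: thinmx0.
apply: (subquots_fg_ext (A := 'rV[R]_n) (B := 'rV[R]_(1 + n))
  (f := linmap (@row0_linear R n)) (g := linmap (@head_linear R n))) => //.
- move=> w /= w0; exists (rsubmx w).
  by rewrite [LHS]split_head w0 scale0r add0r.
- exact: noetherian_regular.
Qed.

Lemma fg_noetherian M : fg M -> noetherian M.
Proof.
move=> [n [p /subquot_surj sp]].
exact: subquots_fg_subquot sp (@noetherian_free n).
Qed.

(** The syzygy module K is again finitely generated, so the presentation can be
    iterated. *)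
Lemma fg_presentation M : fg M ->
  exists n (p : {linear 'rV[R]_n -> M}) (K : lmodType R)
    (i : {linear K -> 'rV[R]_n}),
    [/\ surj p, injective i, fg K & forall w, p w = 0 <-> exists u, w = i u].
Proof.
move=> [n [p sp]].
have kc : is_submod (fun w => p w = 0).
  by split=> [|a x y x0 y0]; rewrite ?linear0 // linearP x0 y0 scaler0 addr0.
have [K [i [ii iP]]] := submodule_exists kc.
exists n, p, K, i; split=> //.
exact: (noetherian_free (subquot_inj ii)).
Qed.

(** The union of the chain is an ideal, and its finitely many generators lie in
    one term of the chain. *)
Lemma ascending_stable (A : nat -> R -> Prop) :
  (forall n, is_submod (A n : R^o -> Prop)) ->
  (forall n x, A n x -> A n.+1 x) ->
  exists n, forall k x, A k x -> A n x.
Proof.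
move=> Ac Am.
have Ale n k x : (n <= k)%N -> A n x -> A k x.
  move=> /subnKC <-; elim: (k - n)%N => [|d IH]; rewrite ?addn0 //.
  by rewrite addnS => /IH/Am.
pose D (x : R^o) := exists n, A n x.
have Dc : is_submod D.
  split; first by exists 0%N; exact: (Ac 0%N).1.
  move=> a x y [n xn] [k yk]; exists (maxn n k); apply: (Ac _).2.
    exact: Ale (leq_maxl _ _) xn.
  exact: Ale (leq_maxr _ _) yk.
have [N NP] := is_submod_closed Dc.
have [s sP] := noeth N.
have sN (i : 'I_(size s)) : D s`_i by apply/NP; exact: generator_in sP i.
have [n nP] := choice sN.
exists (\max_i n i)%N => k x xk.
have /NP/sP[c ->] : D x by exists k.
have [A0 AL] := Ac (\max_i n i)%N.
have nb i : (n i <= \max_i n i)%N by exact: leq_bigmax.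
(* The bound must be opaque for the induction on the sum to find the sum. *)
move: (\max_i n i)%N nb A0 AL => b nb A0 AL.
elim/big_rec: _ => [//|i y _ yA].
by apply: (AL (c i) s`_i y) => //; apply: Ale (nP i); exact: nb.
Qed.

Lemma maximal_ideal_with (Q : (R -> Prop) -> Prop) (A0 : R -> Prop) :
  is_submod (A0 : R^o -> Prop) -> Q A0 ->
  exists A : R -> Prop, [/\ is_submod (A : R^o -> Prop), Q A,
    forall x, A0 x -> A x &
    forall B : R -> Prop, is_submod (B : R^o -> Prop) -> Q B ->
      (forall x, A x -> B x) -> forall x, B x -> A x].
Proof.
move=> c0 Q0; apply: contrapT => none.
pose good (A : R -> Prop) :=
  [/\ is_submod (A : R^o -> Prop), Q A & forall x, A0 x -> A x].
have step (A : {A | good A}) : exists B : {A | good A},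
    (forall x, sval A x -> sval B x) /\ exists x, sval B x /\ ~ sval A x.
  case: A => A [Ac QA A0A] /=; apply: contrapT => nB; apply: none.
  exists A; split=> // B Bc QB AB x Bx; apply: contrapT => nAx; apply: nB.
  have gB : good B by split=> // y /A0A/AB.
  by exists (exist _ B gB); split=> //=; exists x.
have [nxt nxtP] := choice step.
have g0 : good A0 by [].
pose A n := iter n nxt (exist _ A0 g0).
have [|n x xn|n nmax] := @ascending_stable (fun n => sval (A n)).
- by move=> n; have [] := svalP (A n).
- exact: (nxtP (A n)).1.
- have [_ [x [xn nx]]] := nxtP (A n).
  by apply: nx; apply: (nmax n.+1).
Qed.

(** An ideal that is maximal among those disjoint from S is prime: if u and v
    are outside it, the ideals obtained by adjoining u and v meet S, hence so
    does the one obtained by adjoining u * v.  The maximality is kept in the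
    conclusion because S = {1} then yields maximal ideals. *)
Lemma avoiding_prime (S : R -> Prop) (A0 : R -> Prop) :
  S 1 -> (forall x y, S x -> S y -> S (x * y)) ->
  is_submod (A0 : R^o -> Prop) -> (forall x, S x -> ~ A0 x) ->
  exists p : prime_idealr R, [/\ forall x, A0 x -> x \in p,
    forall x, S x -> x \notin p &
    forall n : idealr R, (forall x, S x -> x \notin n) ->
      {subset p <= n} -> n =i p].
Proof.
move=> S1 SM A0c A0S.
have [A [Ac AS A0A Amax]] :=
  @maximal_ideal_with (fun A : R -> Prop => forall x, S x -> ~ A x) A0 A0c A0S.
pose P : {pred R} := fun x => `[< A x >].
have PP x : x \in P <-> A x by split=> [/asboolP|h]; last exact/asboolP.
have Pid : idealr_closed P.
  split; first by apply/PP; exact: Ac.1.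
    by apply/negP => /PP; exact: AS.
  by move=> a u v /PP uA /PP vA; apply/PP; exact: Ac.2.
have adj a : exists B : R -> Prop, [/\ is_submod (B : R^o -> Prop),
    forall x, A x -> B x, B a &
    forall x, B x -> exists r y, A y /\ x = r * a + y].
  exists (fun x => exists r y, A y /\ x = r * a + y); split=> //.
  - split; first by exists 0, 0; rewrite mul0r addr0; split=> //; exact: Ac.1.
    move=> c _ _ [r [y [yA ->]]] [r' [y' [yA' ->]]].
    exists (c * r + r'), (c * y + y'); split; first exact: Ac.2.
    by rewrite -[_ *: _]/(c * _) mulrDr mulrDl addrACA mulrA.
  - by move=> x xA; exists 0, x; rewrite mul0r add0r.
  - by exists 1, 0; rewrite mul1r addr0; split=> //; exact: Ac.1.
have Ppr : prime_idealr_closed P.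
  move=> u v /PP uvA; apply/orP; apply: contrapT => /not_orP[nu nv].
  have hit a : ~ (a \in P) -> exists s r y, [/\ S s, A y & s = r * a + y].
    move=> na; have [B [Bc AB Ba BP]] := adj a.
    apply: contrapT => h; apply: na; apply/PP; apply: (Amax B) => // x Sx Bx.
    by apply: h; have [r [y [yA xE]]] := BP x Bx; exists x, r, y.
  have [s [r [y [Ss yA sE]]]] := hit u nu.
  have [t [q [z [St zA tE]]]] := hit v nv.
  apply: (AS (s * t)); first exact: SM.
  have AM c x : A x -> A (c * x).
    by move=> xA; have := Ac.2 c _ _ xA Ac.1; rewrite addr0.
  have AD x x' : A x -> A x' -> A (x + x').
    by move=> xA xA'; have := Ac.2 1 _ _ xA xA'; rewrite scale1r.
  have -> : s * t = (r * q) * (u * v) + ((q * v) * y + s * z).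
    rewrite tE mulrDr addrA; congr (_ + _).
    by rewrite sE mulrDl mulrACA; congr (_ + _); rewrite mulrC.
  by apply: (AD); [exact: AM|apply: AD; exact: AM].
pose c1 := isIdealr.Build R P Pid.
pose c2 := isPrimeIdealrClosed.Build R P Ppr.
pose p : prime_idealr R := HB.pack P c1 c2.
exists p; split.
- by move=> x /A0A xA; apply/PP.
- by move=> x Sx; apply/negP => /PP; exact: AS.
- move=> n nS pn x; apply/idP/idP; last exact: pn.
  move=> xn; apply/PP; apply: (Amax (fun x => x \in n)) => //.
  + by split=> [|a y z yn zn]; [exact: idealr0|exact: rpredD (idealMr a yn) zn].
  + by move=> y /nS/negP.
  + by move=> y yA; apply/pn/PP.
Qed.

(** A non-unit lies in a maximal ideal, and m is the only one. *)
Lemma local_unit (m : idealr R) (s : R) :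
  local_ring m -> s \notin m -> exists r, r * s = 1.
Proof.
move=> [_ uniq] sm; apply: contrapT => ns; move/negP: sm; apply.
have [|||x -> [r /esym h]|p [sp p1 pmax]] :=
    @avoiding_prime (fun x => x = 1) (fun x => exists r, x = r * s).
- by [].
- by move=> x y -> ->; rewrite mulr1.
- split; first by exists 0; rewrite mul0r.
  move=> a _ _ [r ->] [q ->]; exists (a * r + q).
  by rewrite mulrDl -mulrA.
- by apply: ns; exists r.
- rewrite -(uniq p) ?sp //; first by exists 1; rewrite mul1r.
  by move=> n pn x; apply: pmax => // y ->; rewrite idealr1.
Qed.
End Noetherian.

(** * Vector spaces over the residue field *)

Section Killed.
Variables (R : comNzRingType) (m : idealr R).
Implicit Types A B C M U V : lmodType R.

(** These are the vector spaces over R/m, kept as R-modules. *)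
Definition killed V := forall a (v : V), a \in m -> a *: v = 0.

Definition socle_finite M := subquots_fg killed M.

Lemma killed_subquot V W : subquot V W -> killed V -> killed W.
Proof.
move=> [rho [rl ro rs]] Vk a w am; have [v vw] := ro w; apply: rs.
by rewrite -(Vk a v am); exact: linrelZ.
Qed.

Hypothesis maxm : maximal_ideal m.

Lemma residue_inv a : a \notin m -> exists b, b * a - 1 \in m.
Proof.
move=> am; apply: contrapT => nb.
pose P : {pred R} := fun x => `[< exists r y, y \in m /\ x = r * a + y >].
have Pid : idealr_closed P.
  split.
  - apply/asboolP; exists 0, 0; rewrite mul0r addr0.
    by split=> //; exact: rpred0.
  - apply/negP => /asboolP[r [y [yM h]]]; apply: nb; exists r.
    by rewrite h opprD addrA subrr add0r rpredN.
  - move=> c u v /asboolP[r [y [ym ->]]] /asboolP[q [z [zm ->]]]; apply/asboolP.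
    exists (c * r + q), (c * y + z).
    split; first exact: rpredD (idealMr c ym) zm.
    by rewrite mulrDr mulrDl mulrA addrACA.
pose c1 := isIdealr.Build R P Pid.
pose n : idealr R := HB.pack P c1.
move/negP: am; apply; rewrite -(maxm (n := n)).
  by apply/asboolP; exists 1, 0; rewrite mul1r addr0; split=> //; exact: rpred0.
by move=> x xm; apply/asboolP; exists 0, x; rewrite mul0r add0r.
Qed.

Lemma killed_eq V a b (v : V) : killed V -> a - b \in m -> a *: v = b *: v.
Proof.
by move=> Vk /(Vk _ v)/eqP; rewrite scalerBl subr_eq0 => /eqP.
Qed.

(** An infinite-dimensional vector space contains an infinite independent
    sequence u, and the spans of its tails form a strictly descending chain. *)
Lemma artinian_killed_fg V : artinian V -> killed V -> fg V.
Proof.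
move=> art Vk; apply: contrapT => nfg.
have ext (s : seq V) :
    exists v, forall c : nat -> R, v <> \sum_(0 <= i < size s) c i *: s`_i.
  apply: contrapT => h; apply: nfg; apply: (@fg_seq _ _ s) => x.
  have /existsNP[c /contrapT xE] : ~ forall c : nat -> R,
      x <> \sum_(0 <= i < size s) c i *: s`_i.
    by move=> hx; apply: h; exists x.
  by exists (fun i => c i); rewrite big_mkord in xE.
have [nxt nxtP] := choice ext.
pose l n := iter n (fun s => rcons s (nxt s)) [::].
have szl n : size (l n) = n by elim: n => //= n IH; rewrite size_rcons IH.
pose u n := nxt (l n).
have lE n i : (i < n)%N -> (l n)`_i = u i.
  elim: n => // n IH; rewrite ltnS leq_eqVlt => /orP[/eqP->|lin].
    by rewrite /= nth_rcons szl ltnn eqxx.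
  by rewrite /= nth_rcons szl lin IH.
have indep n (c : nat -> R) : u n <> \sum_(0 <= i < n) c i *: u i.
  have := nxtP (l n) c; rewrite szl => h e; apply: h; rewrite -/(u n) e.
  by apply: eq_big_nat => i /andP[_ /lE ->].
(* A combination of the tail that lies in the span of the head vanishes: its
   last term with a coefficient outside m would be a combination of the
   preceding terms of the sequence. *)
have indep0 n k (c d : nat -> R) : (n <= k)%N ->
    \sum_(n <= i < k) c i *: u i = \sum_(0 <= i < n) d i *: u i ->
    \sum_(n <= i < k) c i *: u i = 0.
  move=> /subnKC <-; elim: (k - n)%N => {k} [|k IH].
    by rewrite addn0 big_geq.
  rewrite addnS big_nat_recr ?leq_addr //=.
  have [cm|cm] := boolP (c (n + k)%N \in m).
    by rewrite (Vk _ _ cm) addr0.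
  have [b bP] := residue_inv cm.
  move=> e; case: (indep (n + k)%N
    (fun i => b * (if (i < n)%N then d i else - c i))).
  rewrite -[LHS]scale1r -(killed_eq _ Vk bP) -scalerA.
  move/(canRL (addKr _)): e => ->.
  rewrite scalerDr scalerN -scaleNr !scaler_sumr.
  rewrite [RHS](@big_cat_nat _ _ _ n) ?leq_addr //=.
  rewrite [RHS]addrC; congr (_ + _); apply: eq_big_nat => i /andP[ni ik].
    by rewrite ltnNge ni /= scalerA mulNr mulrN.
  by rewrite ik scalerA.
have Nc n : is_submod (fun v => exists k (c : nat -> R),
    (n <= k)%N /\ v = \sum_(n <= i < k) c i *: u i).
  split; first by exists n, (fun=> 0); rewrite big_geq.
  have pad k k' (c : nat -> R) : (n <= k)%N -> (k <= k')%N ->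
      \sum_(n <= i < k) c i *: u i =
      \sum_(n <= i < k') (if (i < k)%N then c i else 0) *: u i.
    move=> nk kk'; rewrite [RHS](@big_cat_nat _ _ _ k) //=.
    rewrite [X in _ + X]big1_seq ?addr0.
      by apply: eq_big_nat => i /andP[_ ->].
    move=> i /andP[_]; rewrite mem_index_iota => /andP[ki _].
    by rewrite ltnNge ki /= scale0r.
  move=> a _ _ [k [c [nk ->]]] [k' [c' [nk' ->]]].
  rewrite (pad _ _ c nk (leq_maxl k k')) (pad _ _ c' nk' (leq_maxr k k')).
  exists (maxn k k'), (fun i => a * (if (i < k)%N then c i else 0)
     + (if (i < k')%N then c' i else 0)).
  split; first by rewrite leq_max nk.
  rewrite scaler_sumr -big_split /=; apply: eq_bigr => i _.
  by rewrite scalerDl scalerA.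
have [N NP] := choice (fun n => is_submod_closed (Nc n)).
have [|n nP] := art N.
  move=> n v /NP[k [c [nk ->]]]; apply/NP.
  exists k, (fun i => if i == n then 0 else c i).
  split; first exact: ltnW.
  rewrite [RHS]big_ltn // eqxx scale0r add0r.
  apply: eq_big_nat => i /andP[ni _].
  by rewrite gtn_eqF.
have : u n \in N n.
  by apply/NP; exists n.+1, (fun=> 1); rewrite big_nat1 scale1r leqnSn.
rewrite -(nP n.+1) // => /NP[k [c [nk unE]]].
have u0 : u n = 0.
  rewrite unE; apply: (@indep0 n.+1 k c (fun i => (i == n)%:R)) => //.
  rewrite -unE big_nat_recr //= eqxx scale1r big_nat big1 ?add0r //.
  move=> i /andP[_ ik].
  by rewrite ltn_eqF // scale0r.
apply: (indep n (fun=> 0)); rewrite u0 big1 // => i _; exact: scale0r.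
Qed.

Lemma artinian_subquot A B : subquot A B -> artinian A -> artinian B.
Proof.
move=> [rho [rl ro rs]] art N Ndec.
have Pc n : is_submod (fun a => exists b, b \in N n /\ rho a b).
  split; first by exists 0; split; [exact: rpred0|exact: rl.1].
  move=> c x y [b [bN xb]] [d [dN yd]]; exists (c *: b + d).
  by split; [apply/rpredD/dN/rpredZ|exact: rl.2].
have [L LP] := choice (fun n => is_submod_closed (Pc n)).
have [n x /LP[b [bN xb]]|n nP] := art L.
  by apply/LP; exists b; split=> //; exact: Ndec.
exists n => k nk b; have [a ab] := ro b.
have NL i : b \in N i <-> a \in L i.
  split=> [bN|/LP[b' [bN' ab']]]; first by apply/LP; exists b.
  by rewrite (single_valued_eq rl rs ab ab').
by apply/idP/idP => /NL; [rewrite nP|rewrite -(nP k)] => // /NL.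
Qed.

Hypothesis noeth : noetherian_ring R.

Lemma minimax_socle_finite M : minimax M -> socle_finite M.
Proof.
move=> [L [[s sP] art]].
have [i [ii iP]] := sub_module L.
have [p [_ sp pP]] := quot_module L.
apply: (@subquots_fg_ext R killed (submod L) M (quotmod L) i p).
- exact: killed_subquot.
- by move=> b /pP/iP.
- move=> V LV _; apply: (fg_noetherian noeth) LV I.
  have sN (j : 'I_(size s)) : exists u, s`_j = i u.
    by apply/iP; exact: generator_in sP j.
  have [u uP] := choice sN.
  exists (size s), (lincomb u : {linear _ -> _}) => x.
  have /sP[c cE] : i x \in L by apply/iP; exists x.
  exists (\row_j c j); apply: ii; rewrite cE /= /lincomb linear_sum.
  by apply: eq_bigr => j _; rewrite linearZ mxE uP.
- by move=> V LV; apply: artinian_killed_fg; exact: artinian_subquot LV art.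
Qed.

(** Hom(R^n, M) is a finite power of M, hence an iterated extension. *)
Lemma socle_finite_hom_free n M :
  socle_finite M -> socle_finite (hom 'rV[R]_n M).
Proof.
move=> Mf; elim: n => [|n IH].
  apply: subquots_fg_trivial => f; apply: hom_ext => w.
  by rewrite (thinmx0 w) !linear0.
have l3 : linear (fun f : hom 'rV[R]_(1 + n) M => f (row_mx 1 0)) by [].
pose F := linmap (precomp_linear (M := M) (linmap (@rsub_linear R n))).
apply: (@subquots_fg_ext R killed (hom 'rV[R]_n M) (hom 'rV[R]_(1 + n) M) M
  F (linmap l3)) => //; first exact: killed_subquot.
move=> f /= f0.
exists (f \o linmap (@row0_linear R n) : {linear _ -> _}).
apply: hom_ext => w /=.
by rewrite [in LHS](split_head w) linearP f0 scaler0 add0r.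
Qed.

Lemma socle_finite_hom K M : fg K -> socle_finite M -> socle_finite (hom K M).
Proof.
move=> [n [p sp]] Mf.
apply: (subquots_fg_subquot (B := hom K M) _
  (socle_finite_hom_free (n := n) Mf)).
apply: (@subquot_inj _ _ _ (linmap (precomp_linear (M := M) p))) => f g e.
apply: hom_ext => k; have [w ->] := sp k.
by have := congr1 (fun h : hom 'rV[R]_n M => h w) e.
Qed.

(** If some relation between the n generators has a coefficient outside m, that
    generator is redundant; otherwise the coordinates of a vector are well
    defined modulo m and give the isomorphism with (R/m)^n. *)
Lemma killed_residue_dim V : killed V -> fg V -> exists d, residue_dim m V d.
Proof.
move=> Vk [n]; elim: n => [|n IH] [p sp].
  exists 0%N, (fun=> 0); split=> //; try by move=> *; rewrite ?addr0 ?scaler0.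
  exists (fun=> 0) => [v|w]; last by rewrite (thinmx0 w).
  by have [w ->] := sp v; rewrite (thinmx0 w) linear0.
have [[w [i [pw0 wi]]]|h] := pselect (exists w i, p w = 0 /\ w 0 i \notin m).
  apply: IH; have [b bP] := residue_inv wi.
  exists (lincomb (fun j => p (delta_mx 0 (lift i j))) : {linear _ -> _}) => v.
  have [u ->] := sp v.
  (* Subtracting a multiple of the relation w makes the i-th coordinate lie in
     m, where it no longer contributes. *)
  pose u' := u - (u 0 i * b) *: w.
  have -> : p u = p u' by rewrite linearB linearZ /= pw0 scaler0 subr0.
  have ui : u' 0 i \in m.
    rewrite !mxE -mulrA -{1}[u 0 i]mulr1 -mulrBr -[_ - _]opprB mulrN rpredN.
    exact: idealMr.
  exists (\row_j u' 0 (lift i j)).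
  rewrite lincombE /= /lincomb (bigD1_ord i) //= (Vk _ _ ui) add0r.
  by apply: eq_bigr => j _; rewrite mxE.
have k0 w : p w = 0 -> forall i, w 0 i \in m.
  move=> pw i; apply: contrapT => wi; apply: h.
  by exists w, i; split=> //; exact/negP.
have [c cP] := choice sp.
have rE (a b : R) : residue_proj m a = residue_proj m b <-> a - b \in m.
  by rewrite Quotient.idealrBE; split=> /eqP.
have rD (a b : R) :
    residue_proj m (a + b) = residue_proj m a + residue_proj m b.
  by rewrite /residue_proj !piE.
have rM (a b : R) :
    residue_proj m (a * b) = residue_proj m a * residue_proj m b.
  by rewrite /residue_proj !piE.
have pE (u w : 'rV[R]_n.+1) : p u = p w ->
    forall i, residue_proj m (u 0 i) = residue_proj m (w 0 i).
  move=> e i; apply/rE; have : p (u - w) = 0 by rewrite linearB /= e subrr.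
  by move=> /k0/(_ i); rewrite !mxE.
have pEr (u w : 'rV[R]_n.+1) :
    (forall i, residue_proj m (u 0 i) = residue_proj m (w 0 i)) -> p u = p w.
  move=> h'; apply/eqP; rewrite -subr_eq0 -linearB lincombE /lincomb.
  rewrite big1 // => i _.
  by apply: Vk; rewrite !mxE; apply/rE.
exists n.+1, (fun v => map_mx (residue_proj m) (c v)); split.
- pose rp (x : {ideal_quot m}) : R := repr x.
  have rpK x : residue_proj m (rp x) = x by rewrite /residue_proj reprK.
  exists (fun w : 'rV[{ideal_quot m}]_n.+1 => p (map_mx rp w)) => [v|w].
    by rewrite [RHS]cP; apply: pEr => i; rewrite !mxE rpK.
  apply/matrixP => i j; rewrite ord1 mxE -[RHS]rpK.
  rewrite -[rp _](_ : map_mx rp w 0 j = _).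
    by apply: pE; rewrite -cP.
  by rewrite mxE.
- move=> x y; apply/matrixP => i j; rewrite ord1 !mxE -rD.
  rewrite -[c x 0 j + _](_ : (c x + c y) 0 j = _).
    by apply: pE; rewrite linearD /= -!cP.
  by rewrite mxE.
- move=> a x; apply/matrixP => i j; rewrite ord1 !mxE -rM.
  rewrite -[a * _](_ : (a *: c x) 0 j = _).
    by apply: pE; rewrite linearZ /= -!cP.
  by rewrite mxE.
Qed.
End Killed.

(** * Ext and dimension shifting *)

Section CohomologyClasses.
Variables (R : comNzRingType) (C : complex R) (i : nat).

Definition represents (x : C i) (h : cohomology C i) : Prop :=
  exists z : cycles C i,
    submod_val z = x /\ h = quotmod_proj (@boundaries_pred R C i) z.

Lemma represents_linrel : linrel represents.
Proof.
have [p [pE _ _]] := quot_module (@boundaries_pred R C i).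
split; first by exists 0; split=> //; rewrite -pE linear0.
move=> a x h x' h' [z [<- ->]] [z' [<- ->]]; exists (a *: z + z').
by split=> //; rewrite -!pE linearP.
Qed.

Lemma represents_cycle x h : represents x h -> diff C i x = 0.
Proof. by move=> [[z zc] [<- _]] /=; apply/eqP. Qed.

Lemma represents_exists x : diff C i x = 0 -> exists h, represents x h.
Proof.
move=> /eqP xc; have xc' : x \in submod_pred (@cycles_pred R C i) by exact: xc.
by exists (quotmod_proj (@boundaries_pred R C i) (Submod xc')), (Submod xc').
Qed.

Lemma represents_onto : onto represents.
Proof.
by move=> h; have [z ->] := quotmod_projP h; exists (submod_val z), z.
Qed.

Lemma represents0 x : represents x 0 <-> is_boundary x.
Proof.
split=> [[z [<- /esym/quotmod_proj0/asboolP //]]|xb].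
have /eqP xc : diff C i x = 0.
  case: i x xb => [|j] x /=; first by move=> ->; rewrite linear0.
  by move=> [y ->]; exact: diffK.
have xc' : x \in submod_pred (@cycles_pred R C i) by exact: xc.
exists (Submod xc'); split=> //; apply/esym/quotmod_proj0/asboolP; exact: xb.
Qed.

Lemma represents_single_valued : single_valued represents.
Proof.
have [p [pE _ _]] := quot_module (@boundaries_pred R C i).
move=> h [z [z0 ->]]; have -> : z = 0 by exact: val_inj.
by rewrite -pE linear0.
Qed.

Lemma represents_boundary x h : represents x h -> is_boundary x -> h = 0.
Proof.
move=> xh /represents0 x0.
exact: single_valued_eq represents_linrel represents_single_valued _ _ _ xh x0.
Qed.
End CohomologyClasses.

Section Ext.
Variable R : comNzRingType.
Implicit Types K M X : lmodType R.
Hypothesis noeth : noetherian_ring R.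

Lemma ext0_quotient K X (E : injective_resolution X) :
  exists q : {linear hom K X -> Ext K E 0}, surj q.
Proof.
pose rho (f : hom K X) (e : Ext K E 0) :=
  exists g : hom K (E 0), g = (res_aug E \o f : {linear K -> E 0})
    /\ @represents _ (map_complex (Hom K) E) 0 g e.
have rl : linrel rho.
  apply: linrel_comp; last exact: represents_linrel.
  split; first by apply: hom_ext => k; rewrite /= linear0.
  by move=> a f g f' g' -> ->; apply: hom_ext => k; rewrite /= linearP.
have [||q qP] := linrel_map rl.
- move=> f; have [|e he] := @represents_exists _ (map_complex (Hom K) E) 0
    (res_aug E \o f : {linear K -> E 0}).
    by apply: hom_ext => k /=; apply/res_exact0; exists (f k).
  by exists e; exists (res_aug E \o f : {linear K -> E 0}).
- move=> e [g [-> ge]].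
  apply: represents_single_valued; move: ge; congr (represents _ _).
  by apply: hom_ext => k; rewrite /= linear0.
exists q => e; have [g ge] := represents_onto e.
have [|f fP] := @factor_inj _ _ _ _ (res_aug E) (g : {linear K -> E 0})
  (@res_aug_inj _ _ E).
  move=> k; apply/res_exact0.
  by have := congr1 (fun h : hom K (E 1%N) => h k) (represents_cycle ge).
by exists f; apply/qP; exists g; split=> //; apply: hom_ext => k; rewrite /= fP.
Qed.

(** The connecting map of the long exact sequence, computed on the injective
    resolution of X: a cocycle h on K' extends to g on R^n by injectivity, and
    the differential of g vanishes on K', so it descends to a cocycle f on K.
    It is onto because R^n is free: a cocycle on K, pulled back to R^n, is a
    coboundary. *)
Lemma ext_shift n K K' (p : {linear 'rV[R]_n -> K})
    (i : {linear K' -> 'rV[R]_n}) X (E : injective_resolution X) j :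
  surj p -> injective i -> (forall w, p w = 0 <-> exists u, w = i u) ->
  exists q : {linear Ext K' E j -> Ext K E j.+1}, surj q.
Proof.
move=> sp ii ex.
pose CK := map_complex (Hom K) E; pose CK' := map_complex (Hom K') E.
have pi u : p (i u) = 0 by apply/ex; exists u.
(* A coboundary on K' extends to a cocycle on R^n; in degree 0 the only
   coboundary is 0. *)
have bt (h : hom K' (E j)) : @is_boundary _ CK' j h ->
    exists t : {linear 'rV[R]_n -> E j},
      (forall u, t (i u) = h u) /\ forall w, diff E j (t w) = 0.
  case: j h => [|l] h /=.
    by move=> ->; exists (\0); split=> w //=; rewrite linear0.
  move=> [h' h'P].
  have [g gP] := res_injective (i := l) (h' : {linear K' -> E l}) ii.
  exists (diff E l \o g : {linear _ -> _}).
  by split=> w; [rewrite /= gP h'P | exact: diffK].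
pose rho (e' : Ext K' E j) (e : Ext K E j.+1) :=
  exists (h : hom K' (E j)) (g : hom 'rV[R]_n (E j)) (f : hom K (E j.+1)),
    [/\ @represents _ CK' j h e', forall u, g (i u) = h u,
        forall w, f (p w) = diff E j (g w) & @represents _ CK j.+1 f e].
have rl : linrel rho.
  split.
    exists 0, 0, 0; split=> [||w|]; try exact: (represents_linrel _ _).1.
      by [].
    by rewrite linear0.
  move=> a e1 e e1' e' [h [g [f [he hg gf fe]]]].
  move=> [h' [g' [f' [he' hg' gf' fe']]]].
  exists (a *: h + h'), (a *: g + g'), (a *: f + f'); split.
  - exact: (represents_linrel _ _).2.
  - by move=> u; rewrite /= hg hg'.
  - by move=> w; rewrite /= gf gf' linearP.
  - exact: (represents_linrel _ _).2.
have [||q qP] := linrel_map rl.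
- move=> e'; have [h he] := represents_onto e'.
  have [g gP] := res_injective (i := j) (h : {linear K' -> E j}) ii.
  have [|f fP] := factor_surj (f := (diff E j \o g : {linear _ -> E j.+1})) sp.
    move=> w /ex[u ->] /=; rewrite gP.
    by have := congr1 (fun f : hom K' (E j.+1) => f u) (represents_cycle he).
  have [|e fe] := @represents_exists _ CK j.+1 f.
    apply: hom_ext => k; have [w ->] := sp k.
    by rewrite /= fP /= diffK.
  by exists e, h, g, f.
- move=> e [h [g [f [/represents0 hb hg gf fe]]]].
  apply: (represents_boundary fe) => /=.
  have [t tP] := bt h hb.
  have [|y yP] := factor_surj (f := (g \- t : {linear 'rV[R]_n -> E j})) sp.
    by move=> w /ex[u ->]; rewrite /= hg tP.1 subrr.
  exists y; apply: hom_ext => k; have [w ->] := sp k.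
  by rewrite gf /= yP /= linearB tP.2 subr0.
exists q => e; have [f fe] := represents_onto e.
have [|g gP] := @lift_free _ n (E j) (E j.+1) (diff E j)
  (f \o p : {linear 'rV[R]_n -> E j.+1}).
  move=> w; apply/res_exactS.
  by have := congr1 (fun h : hom K (E j.+2) => h (p w)) (represents_cycle fe).
have [|e' he] := @represents_exists _ CK' j (g \o i : {linear K' -> E j}).
  by apply: hom_ext => u; rewrite /= gP /= pi linear0.
exists e'; apply/qP; exists (g \o i : {linear K' -> E j}), g, f.
by split=> // w; rewrite gP.
Qed.

(** This replaces a free resolution of K: here K' is the j-th syzygy of K. *)
Lemma ext_quotient j K X (E : injective_resolution X) : fg K ->
  exists K', fg K' /\ exists q : {linear hom K' X -> Ext K E j}, surj q.
Proof.
elim: j K => [|j IH] K Kfg.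
  by exists K; split=> //; exact: ext0_quotient.
have [n [p [K' [i [sp ii K'fg ex]]]]] := fg_presentation noeth Kfg.
have [K'' [K''fg [q sq]]] := IH K' K'fg.
have [r sr] := ext_shift E j sp ii ex.
exists K''; split=> //; exists (r \o q : {linear _ -> _}) => e.
by have [e' ->] := sr e; have [f ->] := sq e'; exists f.
Qed.
End Ext.

(** * Bass numbers *)

Section Bass.
Variables (R : comNzRingType) (m : idealr R).
Hypotheses (noeth : noetherian_ring R) (maxm : maximal_ideal m).
Implicit Types K M X : lmodType R.

Lemma residue_killed : killed m (residue_module m).
Proof.
move=> a v am; have [p [pE sp pP]] := quot_module (ideal_pred m).
have [r ->] := sp v; rewrite -linearZ; apply/pP.
by rewrite -[_ *: _]/(a * r) mulrC; exact: idealMr.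
Qed.

Lemma residue_fg : fg (residue_module m).
Proof.
have [p [pE sp pP]] := quot_module (ideal_pred m).
exists 1%N, (p \o linmap (@head_linear R 0) : {linear _ -> _}) => x.
by have [r ->] := sp x; exists (const_mx r); rewrite /= mxE.
Qed.

Lemma ext_killed K X (E : injective_resolution X) j :
  killed m K -> killed m (Ext K E j).
Proof.
move=> Kk a e am; have [f fe] := represents_onto e.
have := linrelZ (represents_linrel _ _) a fe.
rewrite [a *: f](_ : _ = 0); first exact: represents_single_valued.
apply: hom_ext => k; rewrite -[LHS]/(a *: (f : hom K (E j)) k).
by rewrite -linearZ Kk ?linear0.
Qed.

Lemma bass_finite X (E : injective_resolution X) j :
  fg (Ext (residue_module m) E j) -> exists d, bass_number m E j d.
Proof.
by apply: killed_residue_dim => //; apply: ext_killed; exact: residue_killed.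
Qed.

Lemma bass_finite_socle_finite X (E : injective_resolution X) j :
  socle_finite m X -> exists d, bass_number m E j d.
Proof.
move=> Xf; apply: bass_finite.
have [K [Kfg [q sq]]] := ext_quotient noeth j E residue_fg.
apply: (socle_finite_hom Kfg Xf); first exact: subquot_surj sq.
by apply: ext_killed; exact: residue_killed.
Qed.

(** The kernel of p is controlled by N, and Y contributes nothing: multiplication
    by s is bijective on Ext(k, Y) and zero on k.  The proof avoids a resolution
    of Y by working with the presentation q : Hom(K, X) -> Ext^j(k, X): it kills
    every map that lifts to Y, because such a lift is s times another one and s
    kills Ext^j(k, X). *)
Lemma bass_finite_divisible (Y X : lmodType R) (p : {linear Y -> X})
    (N : lmodType R) (i : {linear N -> Y}) (s : R)
    (E : injective_resolution X) j :
  surj p -> (forall y, p y = 0 -> exists u, y = i u) ->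
  injective i -> s \in m ->
  (forall y : Y, exists z, y = s *: z) -> (forall y : Y, s *: y = 0 -> y = 0) ->
  socle_finite m N ->
  exists d, bass_number m E j d.
Proof.
move=> sp ex ii sm sdiv sinj Nf; apply: bass_finite.
have ek := ext_killed (E := E) (j := j) residue_killed.
have [K [Kfg [q sq]]] := ext_quotient noeth j E residue_fg.
have qp0 (f : {linear K -> Y}) : q (p \o f : {linear K -> X}) = 0.
  have lms : linear (fun y : Y => s *: y).
    by move=> a y z; rewrite scalerDr !scalerA mulrC.
  have [||g gP] := @factor_inj _ K Y Y (linmap lms) f.
  - move=> y z /= yz; apply/eqP; rewrite -subr_eq0; apply/eqP/sinj.
    by rewrite scalerBr yz subrr.
  - by move=> k; have [z ->] := sdiv (f k); exists z.
  have -> : (p \o f : {linear K -> X}) =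
      s *: ((p \o g : {linear K -> X}) : hom K X) :> hom K X.
    by apply: hom_ext => k; rewrite /= -gP /= linearZ.
  by rewrite linearZ /= ek.
have [n [pi' [K' [i' [sp' ii' K'fg ex']]]]] := fg_presentation noeth Kfg.
apply: (socle_finite_hom K'fg Nf) ek.
(* With 0 -> K' -> R^n -> K -> 0: the map f on K lifts to g : R^n -> Y, whose
   restriction to K' has values in N.  If that restriction is 0, then g descends
   to K, so f lifts to Y and q f = 0. *)
pose rho (h : hom K' N) (e : Ext (residue_module m) E j) :=
  exists (g : hom 'rV[R]_n Y) (f : hom K X),
    [/\ forall u, g (i' u) = i (h u), forall w, p (g w) = f (pi' w) & e = q f].
exists rho; split.
- split; first by exists 0, 0; split=> [u|w|] /=; rewrite ?linear0.
  move=> a h e h' e' [g [f [hg gf ->]]] [g' [f' [hg' gf' ->]]].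
  exists (a *: g + g'), (a *: f + f').
  split=> [u|w|] /=; last by rewrite linearP.
    by rewrite hg hg' linearP.
  by rewrite linearP /= gf gf'.
- move=> e; have [f ->] := sq e.
  have [|g gP] := @lift_free _ n Y X p (f \o pi' : {linear _ -> _}).
    by move=> w; exact: sp.
  have [|h hP] := @factor_inj _ K' N Y i (g \o i' : {linear _ -> _}) ii.
    move=> u; apply: ex; rewrite /= gP /=.
    by rewrite [pi' _](_ : _ = 0) ?linear0 //; apply/ex'; exists u.
  by exists h, g, f; split=> // u; rewrite hP.
- move=> e [g [f [hg gf ->]]].
  have [|f' f'P] := @factor_surj _ _ K Y pi' g sp'.
    by move=> w /ex'[u ->]; rewrite hg linear0.
  rewrite -(qp0 f'); congr (q _); apply: hom_ext => k.
  by have [w ->] := sp' k; rewrite /= f'P gf.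
Qed.
End Bass.

(** * Torsion and injective modules *)

Section Torsion.
Variables (R : comNzRingType) (S : R -> Prop).
Hypotheses (S1 : S 1) (SM : forall x y, S x -> S y -> S (x * y)).
Implicit Types M : lmodType R.

Definition torsion M (x : M) : Prop := exists s, S s /\ s *: x = 0.

Lemma torsion_submod M : is_submod (@torsion M).
Proof.
split; first by exists 1; rewrite scaler0.
move=> a x y [s [Ss sx]] [t [St ty]]; exists (s * t); split; first exact: SM.
rewrite scalerDr scalerA mulrAC -mulrA mulrC -!scalerA sx ty.
by rewrite !scaler0 addr0.
Qed.

Lemma torsion_scale M s (x : M) : S s -> torsion (s *: x) -> torsion x.
Proof.
move=> Ss [t [St tsx]]; exists (t * s); split; first exact: SM.
by rewrite -scalerA.
Qed.

Lemma S_exp s n : S s -> S (s ^+ n).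
Proof.
by move=> Ss; elim: n => [|n IH]; rewrite ?expr0 // exprS; exact: SM.
Qed.

End Torsion.

Section Divisibility.
Variable R : comNzRingType.
Implicit Types E : lmodType R.

(** The assignment c * r |-> c *: e is well defined on the ideal R r, and
    injectivity extends it to R. *)
Lemma injective_solve E (r : R) (e : E) : injective_module E ->
  (forall c, c * r = 0 -> c *: e = 0) -> exists e', r *: e' = e.
Proof.
move=> Einj re.
have Pc : is_submod (fun x : R^o => exists c, x = c * r).
  split; first by exists 0; rewrite mul0r.
  by move=> a _ _ [c ->] [c' ->]; exists (a * c + c'); rewrite mulrDl -mulrA.
have [U [i [ii iP]]] := submodule_exists Pc.
pose rho (u : U) (y : E) := exists c, i u = c * r /\ y = c *: e.
have rl : linrel rho.
  split; first by exists 0; rewrite linear0 mul0r scale0r.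
  move=> a u y u' y' [c [uc ->]] [c' [uc' ->]]; exists (a * c + c').
  rewrite linearP uc uc' -[_ *: (_ * _)]/(a * (c * r)) mulrDl mulrA.
  by rewrite scalerDl scalerA.
have [||g gP] := linrel_map rl.
- move=> u; have [c uc] := (iP (i u)).2 (ex_intro _ u erefl).
  by exists (c *: e), c.
- by move=> y [c [/esym cr ->]]; apply: re; rewrite cr linear0.
have [h hP] := Einj U R^o i g ii.
have [u ru] : exists u, (r : R^o) = i u by apply/iP; exists 1; rewrite mul1r.
exists (h 1); rewrite -linearZ -[_ *: _]/(r * 1) mulr1 ru hP.
by apply/esym/gP; exists 1; rewrite -ru mul1r scale1r.
Qed.

(** Modulo torsion, e is divisible by s.  The annihilators of the powers of s
    form an ascending chain; if it is stationary from s ^+ n on, the equation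
    s ^+ n.+1 *: e' = s ^+ n *: e meets the condition of [injective_solve]. *)
Lemma injective_divide E (s : R) (e : E) :
  noetherian_ring R -> injective_module E ->
  exists n e', s ^+ n.+1 *: e' = s ^+ n *: e.
Proof.
move=> noeth Einj.
have [n|n x|n nP] := ascending_stable noeth (A := fun n c => c * s ^+ n = 0).
- split; first by rewrite mul0r.
  move=> a x y x0 y0; rewrite -[_ *: _]/(a * x) mulrDl -mulrA x0 y0.
  by rewrite mulr0 addr0.
- by rewrite exprSr mulrA => ->; rewrite mul0r.
have [|e' e'P] := @injective_solve E (s ^+ n.+1) (s ^+ n *: e) Einj.
  by move=> c /nP c0; rewrite scalerA c0 scale0r.
by exists n, e'.
Qed.
End Divisibility.

(** * Local cohomology with respect to a pair of ideals *)

Section LocalCohomology.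
Variables (R : comNzRingType) (I J : submodClosed R^o) (a : R).
Hypothesis noeth : noetherian_ring R.
Hypothesis Ia : forall x : R, x \in I <-> exists r, x = r * a.

(** The multiplicative set whose localization computes the local cohomology
    with respect to ((a), J). *)
Definition denom (s : R) : Prop := exists n (j : R), j \in J /\ s = a ^+ n + j.

Lemma denom1 : denom 1.
Proof. by exists 0%N, 0; rewrite expr0 addr0; split=> //; exact: rpred0. Qed.

Lemma memJM r (j : R) : j \in J -> r * j \in J.
Proof. by move=> jJ; rewrite -[r * j]/(r *: (j : R^o)); exact: rpredZ. Qed.

Lemma memJD (j k : R) : j \in J -> k \in J -> j + k \in J.
Proof. by move=> jJ kJ; exact: (rpredD (jJ : (j : R^o) \in J) kJ). Qed.

Lemma denomM s t : denom s -> denom t -> denom (s * t).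
Proof.
move=> [n [j [jJ ->]]] [k [l [lJ ->]]].
exists (n + k)%N, (a ^+ n * l + (a ^+ k + l) * j); split.
  by apply: memJD; exact: memJM.
by rewrite exprD mulrDl mulrDr !addrA [j * _]mulrC.
Qed.

(** If no element of the multiplicative set kills x, then the annihilator of x
    lies in a prime p that avoids this set.  This p is in the support of R x,
    but it is not in W(I, J), since a ^+ n = c + b with c in J and b in p would
    put a ^+ n - c in p. *)
Lemma GammaP (M : lmodType R) (x : M) :
  x \in @Gamma_pred R I J M <-> torsion denom x.
Proof.
split=> [/asboolP xG|[s [[n [j [jJ sE]]] sx]]]; last first.
  apply/asboolP => p /Supp_cyclicP pS.
  have sp : s \in p by apply: contrapT => /negP/pS.
  (* The exponent n may be 0, while W asks for a positive one. *)
  exists n.+1 => // y [k [c [f [fI ->]]]].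
  have /choice[g gP] i : exists r, c i * \prod_j f i j = r * a ^+ n.+1.
    have /choice[r rP] : forall j, exists r, f i j = r * a.
      by move=> j'; exact/Ia.
    exists (c i * \prod_j r j).
    rewrite (eq_bigr _ (fun j _ => rP j)) big_split /= prodr_const card_ord.
    by rewrite mulrA.
  rewrite (eq_bigr _ (fun i _ => gP i)) -mulr_suml.
  set C := \sum_i g i.
  exists ((- (C * a)) * j), (C * a * s); split.
  - exact: memJM.
  - exact: idealMr.
  - rewrite sE exprS mulrDr mulNr addrC mulrA.
    by rewrite addrK.
apply: contrapT => nt.
have [||||p [xp Sp _]] := @avoiding_prime R noeth denom (fun c => c *: x = 0).
- exact: denom1.
- exact: denomM.
- split; first by rewrite scale0r.
  move=> c r t rx tx; rewrite scalerDl -[c *: r]/(c * r) -scalerA rx tx.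
  by rewrite scaler0 addr0.
- by move=> s Ss sx; apply: nt; exists s.
have [|n n0 nW] := xG p.
  by apply/Supp_cyclicP => u /negP up ux; apply/up/xp.
have [|c [b [cJ bp aE]]] := nW (a ^+ n).
  exists 1%N, (fun=> 1), (fun _ _ => a); split.
    by move=> _ _; apply/Ia; exists 1; rewrite mul1r.
  by rewrite big_ord1 mul1r prodr_const card_ord.
move: bp; apply/negP/Sp; exists n, (- c); split.
  by rewrite -mulN1r; exact: memJM.
by rewrite aE addrAC subrr add0r.
Qed.

Variables (M : lmodType R) (E : injective_resolution M).
Let C := map_complex (Gamma I J) E.

Lemma Gamma_lift i (t : E i) :
  torsion denom t -> exists z : C i, submod_val z = t.
Proof. by move=> /GammaP tG; exists (Submod tG). Qed.

Lemma Gamma_torsion i (z : C i) : torsion denom (submod_val z).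
Proof. by apply/GammaP; case: z. Qed.

Lemma Gamma_diff i (z : C i) :
  submod_val (diff C i z) = diff E i (submod_val z).
Proof. by []. Qed.

Lemma local_cohomology0 m : socle_finite m M ->
  socle_finite m (local_cohomology I J E 0).
Proof.
apply: subquots_fg_subquot.
exists (fun x h => exists z : C 0%N,
  res_aug E x = submod_val z /\ represents z h); split.
- apply: linrel_comp; last exact: represents_linrel.
  split; first by rewrite linear0.
  by move=> c x z x' z' h h'; rewrite linearP h h'.
- move=> h; have [z zh] := represents_onto h.
  have [|x xz] := (@res_exact0 _ _ E (submod_val z)).1.
    by rewrite -Gamma_diff (represents_cycle zh).
  by exists x, z.
- move=> h [z [/esym z0]].
  have -> : z = 0 by apply: val_inj; rewrite /= z0 linear0.
  exact: represents_single_valued.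
Qed.

Lemma local_cohomology_torsionfree i :
  (forall (N : lmodType R) (x : N), torsion denom x -> x = 0) ->
  forall h : local_cohomology I J E i, h = 0.
Proof.
move=> tf h; have [z zh] := represents_onto h.
apply: (@represents_single_valued _ C i).
suff <- : z = 0 by [].
by apply: val_inj; apply: tf; exact: Gamma_torsion.
Qed.

(** A cocycle z of Gamma(E) is d y with y in E^(i+1), and s *: y is a cocycle
    d w for some s in the multiplicative set.  Dividing w by s modulo torsion
    corrects y by a coboundary so that it becomes torsion. *)
Lemma local_cohomology_ge2 i (h : local_cohomology I J E i.+2) : h = 0.
Proof.
have [z zh] := represents_onto h.
apply: (represents_boundary zh).
have [|y yz] := (@res_exactS _ _ E _ (submod_val z)).1.
  by rewrite -Gamma_diff (represents_cycle zh).
have [s [Ss sz]] := Gamma_torsion z.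
have [|w wy] := (@res_exactS _ _ E _ (s *: y)).1.
  by rewrite linearZ /= -yz.
have [n [w' w'P]] := injective_divide s w noeth (res_injective (i := i)).
have [|t tP] := @Gamma_lift i.+1 (y - diff E i w').
  exists (s ^+ n.+1); split; first exact: S_exp denom1 denomM _ _ Ss.
  have dw' : s ^+ n.+1 *: diff E i w' = s ^+ n *: (s *: y).
    by rewrite wy -!linearZ /= w'P.
  by rewrite scalerBr dw' scalerA -exprSr subrr.
exists t; apply: val_inj; rewrite /= tP linearB diffK subr0.
exact: yz.
Qed.

(** With D = E^0/Gamma(E^0), let Y be the set of all classes in D of elements
    y with d y torsion, and send the class of y to the cohomology class of d y.
    The kernel of this map is the image N of M in D. *)
Lemma bass_local_cohomology1 m s j
    (E' : injective_resolution (local_cohomology I J E 1)) :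
  maximal_ideal m -> socle_finite m M -> denom s -> s \in m ->
  exists d, bass_number m E' j d.
Proof.
move=> maxm Mf Ss sm.
have [D [p [sp pP]]] := quotient_exists (torsion_submod denom1 denomM (E 0%N)).
have tc := torsion_submod denom1 denomM (E 1%N).
have [Y [i [ii iP]]] : exists (Y : lmodType R) (i : {linear Y -> D}),
    injective i /\ forall x,
    (exists y, x = p y /\ torsion denom (diff E 0 y)) <-> exists u, x = i u.
  apply: submodule_exists; split.
    by exists 0; rewrite !linear0; split=> //; exact: tc.1.
  move=> c _ _ [y [-> yt]] [z [-> zt]]; exists (c *: y + z).
  by rewrite !linearP; split=> //; exact: tc.2.
pose rho (u : Y) (h : local_cohomology I J E 1) :=
  exists (y : E 0%N) (z : C 1%N),
    [/\ i u = p y, submod_val z = diff E 0 y & represents z h].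
have rl : linrel rho.
  split.
    exists 0, 0; rewrite !linear0; split=> //.
    exact: (represents_linrel _ _).1.
  move=> c u h u' h' [y [z [uy zy zh]]] [y' [z' [uy' zy' zh']]].
  exists (c *: y + y'), (c *: z + z'); rewrite !linearP uy uy' /= zy zy'.
  by split=> //; exact: (represents_linrel _ _).2.
have dz (z : C 1%N) (y : E 0%N) : submod_val z = diff E 0 y -> diff C 1 z = 0.
  by move=> zy; apply: val_inj; rewrite /= zy diffK.
have [||q qP] := linrel_map rl.
- move=> u.
  have [y [uy /Gamma_lift[z zy]]] := (iP (i u)).2 (ex_intro _ u erefl).
  by have [h zh] := represents_exists (dz z y zy); exists h, y, z.
- move=> h [y [z [/esym yu zy zh]]].
  apply: (represents_boundary zh).
  have /pP/Gamma_lift[t ty] : p y = 0 by rewrite yu linear0.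
  by exists t; apply: val_inj; rewrite /= ty zy.
have [N [k [ik kP]]] : exists (N : lmodType R) (k : {linear N -> Y}),
    injective k /\ forall u,
    (exists x, i u = p (res_aug E x)) <-> exists v, u = k v.
  apply: submodule_exists; split; first by exists 0; rewrite !linear0.
  by move=> c u v [x ux] [y vy]; exists (c *: x + y); rewrite !linearP ux vy.
have pdiv e : exists e' n, p e = s *: p e' /\ s ^+ n.+1 *: e' = s ^+ n *: e.
  have [n [e' e'P]] := injective_divide s e noeth (res_injective (i := 0%N)).
  exists e', n; split=> //; apply/eqP; rewrite -subr_eq0 -linearZ -linearB.
  apply/eqP/pP; exists (s ^+ n); split; first exact: S_exp denom1 denomM _ _ Ss.
  by rewrite scalerBr scalerA -exprSr e'P subrr.
apply: (bass_finite_divisible noeth maxm (p := q) (i := k) (s := s)) => //.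
- move=> h; have [z zh] := represents_onto h.
  have [|y zy] := (@res_exactS _ _ E _ (submod_val z)).1.
    by rewrite -Gamma_diff (represents_cycle zh).
  have [|u uy] := (iP (p y)).1.
    by exists y; split=> //; rewrite -zy; exact: Gamma_torsion.
  by exists u; apply/qP; exists y, z.
- move=> u /esym/qP[y [z [uy zy /represents0[t zt]]]]; apply/kP.
  have [|x xy] := (@res_exact0 _ _ E (y - submod_val t)).1.
    by rewrite linearB -zy zt Gamma_diff subrr.
  exists x; rewrite -xy linearB uy [p (submod_val t)](_ : _ = 0) ?subr0 //.
  by apply/pP; exact: Gamma_torsion.
- move=> u; have [y [uy [t [St ty]]]] := (iP (i u)).2 (ex_intro _ u erefl).
  have [e [n [ye se]]] := pdiv y.
  have [|v ev] := (iP (p e)).1.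
    exists e; split=> //; exists (t * s ^+ n.+1); split.
      by apply: denomM => //; exact: S_exp denom1 denomM _ _ Ss.
    have dse : s ^+ n.+1 *: diff E 0 e = s ^+ n *: diff E 0 y.
      by rewrite -!linearZ /= se.
    by rewrite -scalerA dse scalerA mulrC -scalerA ty scaler0.
  by exists v; apply: ii; rewrite linearZ -ev uy.
- move=> u su; apply: ii; rewrite linear0.
  have [y uy] := sp (i u); rewrite uy; apply/pP.
  apply: (torsion_scale denomM Ss); apply/pP.
  by rewrite linearZ -uy -linearZ su linear0.
- apply: subquots_fg_subquot Mf.
  exists (fun x v => p (res_aug E x) = i (k v)); split.
  + split; first by rewrite !linear0.
    by move=> c x v x' v' h h'; rewrite !linearP h h'.
  + move=> v; have [x xv] := (kP (k v)).2 (ex_intro _ v erefl).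
    by exists x.
  + move=> v; rewrite !linear0 => /esym; rewrite -(linear0 i) => /ii.
    by rewrite -(linear0 k) => /ik.
Qed.
End LocalCohomology.

Theorem corollary2p7 (R : comNzRingType) (m : idealr R)
  (I J : submodClosed R^o) (M : lmodType R) :
  noetherian_ring R -> local_ring m -> principal_ideal I -> minimax M ->
  forall (E : injective_resolution M) (i j : nat)
    (E' : injective_resolution (local_cohomology I J E i)),
  exists d : nat, bass_number m E' j d.
Proof.
move=> noeth loc [a Ia] Mmin E.
have maxm := loc.1.
have Mf : socle_finite m M by exact: minimax_socle_finite.
have zero i j (E' : injective_resolution (local_cohomology I J E i)) :
    (forall h : local_cohomology I J E i, h = 0) ->
    exists d, bass_number m E' j d.
  move=> h0; apply: bass_finite_socle_finite => //.
  exact: subquots_fg_trivial.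
have [[s [Ss sm]]|disj] := pselect (exists s, denom J a s /\ s \in m);
  last first.
  move=> i j E'; apply: zero => h.
  apply: (local_cohomology_torsionfree noeth Ia) => N x.
  move=> [s [Ss sx]]; have [|r rs] := local_unit noeth loc (s := s).
    by apply/negP => sm; apply: disj; exists s.
  by rewrite -[x]scale1r -rs -scalerA sx scaler0.
case=> [|[|i]] j E'.
- by apply: bass_finite_socle_finite => //; exact: local_cohomology0 Mf.
- exact: bass_local_cohomology1 sm.
- by apply: zero; exact: local_cohomology_ge2.
Qed.
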